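(* For every $n\ge 1$ there is a bijection $\phi^{(D)}_V:\mathcal{VS}^{(D)}_n\to\mathcal{T}^*_n$ which, for each $1\le k\le n$, restricts to a bijection from $\mathcal{VS}^{(D)}_{n,k}$ onto $\mathcal{T}^*_{n,k}$.
   Context: Signed permutations in window notation $\sigma=\sigma_1\cdots\sigma_n$ (entries in $\{\pm1,\dots,\pm n\}$, absolute values a permutation of $[n]$), $\bar a=-a$, $|\sigma|=|\sigma_1|\cdots|\sigma_n|$. Position $i$ of a sequence $w$ of distinct positive integers is a valley if $2\le i\le n-1$ and $w_{i-1}>w_i<w_{i+1}$, or $i=1$ and $w_1<w_2$. $\mathcal{VS}^{(D)}_n$: signed permutations with $\sigma_1<0$, $|\sigma_1|>\sigma_2>0$ (when $n\ge2$), and such that for $i\ge 3$, $\sigma_i<0$ implies $|\sigma_{i-1}|$ is a valley of $|\sigma|$; $\mathcal{VS}^{(D)}_{n,k}$: those with $\sigma_1=\bar k$. $\mathcal{T}_n$: complete increasing binary trees with $n$ labelled nodes — plane rooted trees in which every node is a leaf or has two ordered children (left, right), exactly $n$ nodes labelled bijectively by $[n]$, all non-leaf nodes labelled (leaves may be labelled or empty), labels increasing along paths from the root. Rightmost path $(v_1,\dots,v_d)$: $v_1$ the root, $v_{i+1}$ the right child of $v_i$, $v_d$ a leaf. $\mathcal{T}^*_n$: trees with $v_d$ labelled; the rightmost label of such a tree is the label of $v_d$. $\mathcal{T}^*_{n,k}$: those with rightmost label $k$. *)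

(* Defs.v *)
From mathcomp Require Import all_boot all_order all_algebra.
From mathcomp Require Import mathcomp_extra boolp classical_sets functions.

Set Implicit Arguments.
Unset Strict Implicit.
Unset Printing Implicit Defensive.

Import Order.TTheory GRing.Theory Num.Theory.
Local Open Scope classical_set_scope.
Local Open Scope ring_scope.

(* Window positions are numbered from 1: [win s i], i.e. sigma_i, is
   only meaningful for 1 <= i <= n. *)
Definition win (s : seq int) (i : nat) : int := nth 0 s i.-1.

Definition abs_word (s : seq int) : seq nat := [seq `|x|%N | x <- s].

Definition signed_perm (n : nat) (s : seq int) : bool :=
  perm_eq (abs_word s) (iota 1 n).

(* Position i (numbered from 1) is a valley of w; position 1 is compared with
   its right neighbour only, and the last position is never a valley. *)
Definition valley (w : seq nat) (i : nat) : bool :=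
  let w_ j := nth 0%N w j.-1 in
  (1 <= i < size w)%N && (w_ i < w_ i.+1)%N
    && ((i == 1%N) || (w_ i < w_ i.-1)%N).

Definition VSD (n : nat) : set (seq int) :=
  [set s | [/\ signed_perm n s,
               win s 1 < 0,
               (2 <= n)%N -> 0 < win s 2 < `|win s 1|
             & forall i : nat, (3 <= i <= n)%N ->
                 win s i < 0 -> valley (abs_word s) i.-1]].

Definition VSDk (n k : nat) : set (seq int) :=
  [set s | VSD n s /\ win s 1 = - k%:Z].

(* Plane binary trees in which every node is a leaf or has two ordered
   children; a leaf is either labelled ([Leaf (Some a)]) or empty
   ([Leaf None]), and an inner node always carries a label. *)
Inductive tree : Type :=
  | Leaf of option nat
  | Node of nat & tree & tree.

Fixpoint labels (t : tree) : seq nat :=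
  match t with
  | Leaf None => [::]
  | Leaf (Some a) => [:: a]
  | Node a l r => a :: labels l ++ labels r
  end.

Fixpoint increasing (t : tree) : bool :=
  match t with
  | Leaf _ => true
  | Node a l r =>
      [&& all (fun b => a < b)%N (labels l ++ labels r), increasing l
        & increasing r]
  end.

Definition Tn (n : nat) : set tree :=
  [set t | perm_eq (labels t) (iota 1 n) /\ increasing t].

(* The label, if any, of the leaf at the end of the rightmost path. *)
Fixpoint rightmost_label (t : tree) : option nat :=
  match t with
  | Leaf o => o
  | Node _ _ r => rightmost_label r
  end.

Definition Tstar (n : nat) : set tree :=
  [set t | Tn n t /\ rightmost_label t <> None].

Definition Tstark (n k : nat) : set tree :=
  [set t | Tstar n t /\ rightmost_label t = Some k].

(* Main.v *)
Require Import Defs.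
From mathcomp Require Import all_boot all_order all_algebra.
From mathcomp Require Import mathcomp_extra boolp classical_sets functions.
From mathcomp Require Import zify.

Set Implicit Arguments.
Unset Strict Implicit.
Unset Printing Implicit Defensive.

Import Order.TTheory GRing.Theory Num.Theory.

(** Write a word of VS^(D) as [-k] followed by blocks, each starting
    at a left-to-right minimum [a] of the absolute values. The condition
    [sigma_2 < k] says that all the block minima are below [k], and they are
    positive; so they can serve, in increasing order, as the labels on a
    rightmost path ending in [k]. What follows [a] in its block is a word with a
    free first sign and valley-signed afterwards; such words are in bijection
    with the increasing trees hanging to the left of [a]. Indeed, splitting such
    a word at its minimum [b] as [u b v] with [u] nonempty, [b] is positive and
    [u], [v] are words of the same kind: these are the subtrees of [b]. If [u]
    is empty and [v] is not, [b] has a free sign and the first letter of [v] is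
    positive, and the sign of [b] is moved to [v]. Finally the words [-b] and
    [b] give a labelled leaf and a node with two empty leaves. *)

(* [p] and [q] are the absolute values of the two letters preceding [s].
   [vsigned 1 0] leaves the first sign free and makes the second letter
   positive; [vsigned 0 q] makes the first letter positive. *)
Fixpoint vsigned (p q : nat) (s : seq int) : bool :=
  if s is x :: s' then
    ((x < 0)%R ==> (q < p) && (q < `|x|)) && vsigned q `|x| s'
  else true.

(** The default [0] of [head] makes the middle test hold on a negative one-letter word; the state
    [0], [|x|] forbids a negative second letter. *)
Definition vsd (s : seq int) : bool :=
  if s is x :: s' then
    [&& (x < 0)%R, head 0 (abs_word s') < `|x| & vsigned 0 `|x| s']
  else false.

Definition glue (a : nat) (u v : seq int) : seq int :=
  if u is [::] then
    if v is x :: v' then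
      (if (x < 0)%R then - Posz a else Posz a)%R :: Posz `|x| :: v'
    else [:: Posz a]
  else u ++ Posz a :: v.

Fixpoint tree_word (t : tree) : seq int :=
  match t with
  | Leaf None => [::]
  | Leaf (Some a) => [:: (- Posz a)%R]
  | Node a l r => glue a (tree_word l) (tree_word r)
  end.

(** The right subtree is written first: block minima decrease along the word, while labels increase
    down the path. The end leaf thus supplies the first letter. *)
Fixpoint path_word (t : tree) : seq int :=
  match t with
  | Leaf None => [::]
  | Leaf (Some a) => [:: (- Posz a)%R]
  | Node a l r => path_word r ++ Posz a :: tree_word l
  end.

(** * Cutting and gluing signed words at their minimum *)

Lemma abs_word_cat u v : abs_word (u ++ v) = abs_word u ++ abs_word v.
Proof. exact: map_cat. Qed.

(** [p] enters only through the test [q < p], which fails on both sides. *)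
Lemma vsigned_low p p' q s : p <= q -> p' <= q -> vsigned p q s = vsigned p' q s.
Proof. by case: s => [|x s] //= hp hp'; rewrite !ltnNge hp hp'. Qed.

(** Here [q] is a valley as soon as a letter follows, so the sign of that letter is free. Being
    larger than [q], that letter is no valley, so the next one is nonnegative: this is the state
    [1 0]. *)
Lemma vsigned_after_min p q s : q < p -> all (ltn q) (abs_word s) ->
  vsigned p q s = vsigned 1 0 s.
Proof.
case: s => [|x s] //= qp /andP[qx _]; rewrite qp qx implybT /=.
rewrite (_ : _ ==> _ = true) /=; last by apply/implyP; lia.
by apply: vsigned_low; lia.
Qed.

(** The value before [x] exceeds [|x|], hence is no valley, which forces the sign of [x]; then [v]
    is read right after a new minimum. *)
Lemma vsigned_cat_min p q u x v :
  `|x| < last q (abs_word u) -> all (ltn `|x|%N) (abs_word v) ->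
  vsigned p q (u ++ x :: v) = [&& (0 <= x)%R, vsigned p q u & vsigned 1 0 v].
Proof.
elim: u p q => [|y u IH] p q /= hx hv.
  rewrite (vsigned_after_min hx hv) [q < `|x|]ltnNge (ltnW hx) andbF implybF.
  by rewrite -leNgt.
by rewrite IH //; case: (_ ==> _); rewrite /= ?andbF.
Qed.

(** If the sizes differed, each of [a] and [a'] would lie on one side of the cut at the other,
    giving both [a < a'] and [a' < a]. *)
Lemma min_split_inj (a a' : nat) (u u' v v' : seq nat) :
  u ++ a :: v = u' ++ a' :: v' ->
  all (ltn a) (u ++ v) -> all (ltn a') (u' ++ v') -> size u = size u'.
Proof.
elim: u u' => [|x u IH] [|x' u'] //=.
- case=> -> ->; rewrite all_cat /= => /and3P[_ h _] /andP[h' _].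
  by move: h h' => /=; lia.
- case=> <- <- /andP[h _]; rewrite all_cat /= => /and3P[_ h' _].
  by move: h h' => /=; lia.
- by case=> _ /IH e /andP[_ h] /andP[_ h']; rewrite e.
Qed.

Lemma cat_min_inj (a a' : nat) (u u' v v' : seq int) :
  u ++ Posz a :: v = u' ++ Posz a' :: v' ->
  all (ltn a) (abs_word u ++ abs_word v) ->
  all (ltn a') (abs_word u' ++ abs_word v') -> [/\ a = a', u = u' & v = v'].
Proof.
move=> e h h'; have := congr1 abs_word e; rewrite !abs_word_cat /= => ea.
have := min_split_inj ea h h'; rewrite !size_map => es.
by move/eqP: e; rewrite eqseq_cat // => /andP[/eqP -> /eqP[-> ->]].
Qed.

Lemma abs_word_glue a u v :
  abs_word (glue a u v) = abs_word u ++ a :: abs_word v.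
Proof.
case: u v => [|y u] [|x v] //=; rewrite ?abs_word_cat //.
by congr [:: _, _ & _]; first case: ifP => _; lia.
Qed.

(** Absolute values locate the cut. When [u] is empty, the sign taken from [v] is read off the first
    letter, unambiguously since [a] is positive. *)
Lemma glue_inj (a a' : nat) (u u' v v' : seq int) :
  glue a u v = glue a' u' v' ->
  0 < a -> all (ltn a) (abs_word u ++ abs_word v) ->
  0 < a' -> all (ltn a') (abs_word u' ++ abs_word v') ->
  [/\ a = a', u = u' & v = v'].
Proof.
move=> e a0 h a0' h'; have := congr1 abs_word e; rewrite !abs_word_glue => ea.
have := min_split_inj ea h h'; rewrite !size_map.
case: u u' e ea h h' => [|y u] [|y' u'] //= e ea h h'; last first.
  by move=> _; exact: (@cat_min_inj a a' (y :: u) (y' :: u')) e h h'.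
case: ea => ea _ _; rewrite -{}ea in e h' *.
case: v v' e h h' => [|x v] [|x' v'] //=.
case=> e1 e2 -> /andP[/= h _] /andP[/= h' _]; split=> //; congr (_ :: _).
by move: e1; case: ifP; case: ifP; lia.
Qed.

Lemma glue_neq_leaf (a b : nat) u v : 0 < a -> 0 < b ->
  [:: (- Posz b)%R] <> glue a u v.
Proof.
move=> a0 b0; case: u v => [|y [|z u]] [|x v] //=; case; lia.
Qed.

Lemma vsigned_glue a u v : 0 < a ->
  all (ltn a) (abs_word u ++ abs_word v) ->
  vsigned 1 0 u -> vsigned 1 0 v -> vsigned 1 0 (glue a u v).
Proof.
move=> a0; rewrite all_cat => /andP[hu hv] vu vv.
case: u hu vu => [|y u] hu vu; last first.
  have -> : glue a (y :: u) v = (y :: u) ++ Posz a :: v by [].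
  rewrite vsigned_cat_min ?vu ?vv //=.
  have /allP := hu; apply; exact: mem_last.
case: v hv vv => [|x v] /= /[dup] hv //.
move=> /andP[ax _] /andP[_ vv].
rewrite (_ : _ ==> _ = true) /=; last by case: ifP; lia.
have xq : vsigned a `|x| v by rewrite (vsigned_low (p' := 0)) // ltnW.
by case: ifP => _; rewrite ?abszN.
Qed.

(** * Increasing trees and words with a free first sign *)

Lemma perm_tree_word t : perm_eq (abs_word (tree_word t)) (labels t).
Proof.
elim: t => [[a|]|a l IHl r IHr] //=; first by rewrite /= abszN.
rewrite abs_word_glue perm_sym -cat1s perm_catCA perm_sym /=.
by rewrite perm_cat // perm_cons.
Qed.

Lemma perm_path_word t : perm_eq (abs_word (path_word t)) (labels t).
Proof.
elim: t => [[a|]|a l _ r IHr] //=; first by rewrite /= abszN.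
rewrite abs_word_cat /= -cat1s perm_catCA /= perm_cons perm_catC.
by rewrite perm_cat // perm_tree_word.
Qed.

Lemma vsigned_tree_word t : all (ltn 0) (labels t) -> increasing t ->
  vsigned 1 0 (tree_word t).
Proof.
elim: t => [[a|]|a l IHl r IHr] //=; first by rewrite andbT; lia.
rewrite !all_cat => /and3P[a0 pl pr] /and3P[hlr il ir].
apply: vsigned_glue; rewrite ?IHl ?IHr //.
by rewrite all_cat !(perm_all _ (perm_tree_word _)).
Qed.

Lemma tree_word_inj t t' :
  all (ltn 0) (labels t) -> increasing t ->
  all (ltn 0) (labels t') -> increasing t' ->
  tree_word t = tree_word t' -> t = t'.
Proof.
have glueN0 a u v : glue a u v <> [::] by case: u v => [|? ?] [|? ?].
elim: t t' => [[a|]|a l IHl r IHr] [[a'|]|a' l' r'] //=.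
- by move=> _ _ _ _ [e]; congr (Leaf (Some _)); lia.
- by move=> /andP[a0 _] _ /andP[a0' _] _ /glue_neq_leaf; case.
- by move=> _ _ _ _ /esym/glueN0.
- by move=> /andP[a0 _] _ /andP[a0' _] _ /esym/glue_neq_leaf; case.
- by move=> _ _ _ _ /glueN0.
rewrite !all_cat => /and3P[a0 pl pr] /and3P[hlr il ir].
move=> /and3P[a0' pl' pr'] /and3P[hlr' il' ir'] /glue_inj[] //.
- by rewrite all_cat !(perm_all _ (perm_tree_word _)).
- by rewrite all_cat !(perm_all _ (perm_tree_word _)).
by move=> -> /IHl -> // /IHr ->.
Qed.

Lemma split_at_min (s : seq int) : s != [::] -> uniq (abs_word s) ->
  exists u x v, s = u ++ x :: v /\ all (ltn `|x|%N) (abs_word u ++ abs_word v).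
Proof.
elim: s => [|y s IH] //= _ /andP[ys us].
have [->|s0] := eqVneq s [::]; first by exists [::], y, [::].
have [u [x [v [es h]]]] := IH s0 us.
rewrite es abs_word_cat /= in ys.
have {}ys : y \notin [::] /\ `|y| != `|x|.
  by move: ys; rewrite mem_cat inE; case: (_ == _) => //; rewrite orbT.
have [yx|xy] := ltnP `|y| `|x|.
  exists [::], y, s; split=> //=; rewrite es abs_word_cat all_cat /= yx /=.
  by rewrite -all_cat; apply: sub_all h => z; apply: ltn_trans.
exists (y :: u), x, v; split; first by rewrite es.
by rewrite /= h andbT; move: ys => [_ ys]; rewrite ltn_neqAle eq_sym ys.
Qed.

Lemma tree_word_surj s : uniq (abs_word s) -> all (ltn 0) (abs_word s) ->
  vsigned 1 0 s -> exists t, increasing t /\ tree_word t = s.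
Proof.
have [m] := ubnP (size s); elim: m s => // m IH s sm us ps vs.
have node (a : nat) u v :
    uniq (abs_word u) -> uniq (abs_word v) ->
    all (ltn a) (abs_word u ++ abs_word v) ->
    size u < m -> size v < m -> vsigned 1 0 u -> vsigned 1 0 v ->
    exists t, increasing t /\ tree_word t = glue a u v.
  move=> uu uv; rewrite all_cat => /andP[hu hv] su sv vu vv.
  have pos w : all (ltn a) (abs_word w) -> all (ltn 0) (abs_word w).
    by apply: sub_all => z; apply: leq_ltn_trans.
  have [l [il el]] := IH u su uu (pos _ hu) vu.
  have [r [ir er]] := IH v sv uv (pos _ hv) vv.
  exists (Node a l r); rewrite /= il ir el er; split=> //.
  by rewrite !andbT all_cat -!(perm_all _ (perm_tree_word _)) el er hu.
have [s0|s0] := eqVneq s [::]; first by exists (Leaf None); rewrite s0.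
have [u [x [v [es h]]]] := split_at_min s0 us; subst s.
move: us ps sm vs.
rewrite abs_word_cat cat_uniq all_cat size_cat /=.
move=> /and4P[uu _ _ uv] /and3P[pu px pv] sm vs.
have /andP[hu hv] : all (ltn `|x|%N) (abs_word u) && all (ltn `|x|%N) (abs_word v).
  by rewrite -all_cat.
case: u hu uu pu h s0 sm vs => [|y u] hu uu pu h s0 sm vs; last first.
  move: vs; rewrite vsigned_cat_min //; last first.
    by have /allP := hu; apply; exact: mem_last.
  move=> /and3P[x0 vu vv].
  have [||t [it et]] := node `|x|%N (y :: u) v uu uv h _ _ vu vv.
  - by move: sm => /=; lia.
  - by move: sm => /=; lia.
  by exists t; split=> //; rewrite et /= gez0_abs.
case: v hv uv pv h sm vs {s0 hu uu pu} => [|y v] hv uv pv h sm vs.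
  (* For a one-letter word the sign separates a labelled leaf from a node with two empty leaves. *)
  have [x0|x0] := ltP x 0%R.
    by exists (Leaf (Some `|x|%N)); split=> //=; congr [:: _]; lia.
  by exists (Node `|x|%N (Leaf None) (Leaf None)); rewrite /= gez0_abs.
move: vs hv pv uv sm => /= /and3P[_ y0 vv] /andP[/= xy hv] /andP[py _] uv sm.
rewrite implybF -leNgt in y0.
(* [glue] moves the sign of the first letter of the right word onto the minimum; giving [y] the sign
   of [x] undoes this. *)
pose z := (if x < 0 then - y else y)%R.
have zy : `|z| = `|y| by rewrite /z; case: ifP => _; lia.
have [|||||||t [it et]] := node `|x|%N [::] (z :: v); rewrite ?zy //=.
- by rewrite zy.
- by rewrite zy xy.
- by lia.
- rewrite zy (vsigned_low (p' := `|x|%N)) ?vv ?andbT //; last by lia.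
  by apply/implyP; lia.
exists t; split=> //; rewrite et /= zy (gez0_abs y0); congr (_ :: _).
by rewrite /z; case: (ltP x 0%R) => ?; case: ifP; lia.
Qed.

(** * Words of trees with a labelled rightmost leaf *)

Lemma path_word_head t k : rightmost_label t = Some k ->
  exists s, path_word t = (- Posz k)%R :: s.
Proof.
elim: t => [o|a l _ r IHr] /=; first by move=> ->; exists [::].
by move=> /IHr [s ->]; exists (s ++ Posz a :: tree_word l).
Qed.

Lemma vsd_cat_min s a v : 0 < a -> all (ltn a) (abs_word s ++ abs_word v) ->
  s != [::] -> vsd (s ++ Posz a :: v) = vsd s && vsigned 1 0 v.
Proof.
case: s => [|x s] //= a0; rewrite all_cat => /andP[/= ax /andP[hs hv]] _.
rewrite vsigned_cat_min //=; last first.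
  have /allP : all (ltn a) (abs_word (x :: s)) by rewrite /= ax.
  by apply; exact: mem_last.
(* If [s] was a single letter, the tests on the second letter compare [|x|] with [a] on the left and
   with the default [0] on the right; both hold. *)
by case: s hs => [|y s] hs /=; rewrite ?ax ?(leq_ltn_trans (leq0n a) ax) ?andbT /= -?andbA.
Qed.

Lemma vsd_path_word t : all (ltn 0) (labels t) -> increasing t ->
  rightmost_label t <> None -> vsd (path_word t).
Proof.
elim: t => [[a|]|a l _ r IHr] //=.
  by rewrite abszN !andbT => a0 _ _; rewrite a0 andbT; lia.
rewrite !all_cat => /and3P[a0 pl pr] /and3P[/andP[hl hr] il ir] rm.
have s0 : path_word r != [::].
  by case e: (rightmost_label r) rm => [k|//] _; have [s ->] := path_word_head e.
rewrite vsd_cat_min //; first by rewrite IHr // vsigned_tree_word.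
by rewrite all_cat (perm_all _ (perm_path_word _))
           (perm_all _ (perm_tree_word _)) hr.
Qed.

Lemma path_word_inj t t' :
  all (ltn 0) (labels t) -> increasing t -> rightmost_label t <> None ->
  all (ltn 0) (labels t') -> increasing t' -> rightmost_label t' <> None ->
  path_word t = path_word t' -> t = t'.
Proof.
(* Length separates nodes from leaves, whose words have at most one letter. *)
have path_wordS a l r : rightmost_label r <> None ->
    1 < size (path_word (Node a l r)).
  case e: (rightmost_label r) => [k|//] _ /=; have [s ->] := path_word_head e.
  by rewrite size_cat /= addnS.
elim: t t' => [[a|]|a l _ r IHr] [[a'|]|a' l' r'] //=.
- by move=> _ _ _ _ _ _ [e]; congr (Leaf (Some _)); lia.
- by move=> _ _ _ _ _ /(path_wordS a' l') /[swap] /= <-.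
- by move=> _ _ /(path_wordS a l) /[swap] _ /[swap] _ /[swap] _ /[swap] /= ->.
rewrite !all_cat => /and3P[a0 pl pr] /and3P[/andP[hl hr] il ir] rm.
move=> /and3P[a0' pl' pr'] /and3P[/andP[hl' hr'] il' ir'] rm' /cat_min_inj[].
- by rewrite all_cat (perm_all _ (perm_path_word _))
             (perm_all _ (perm_tree_word _)) hr.
- by rewrite all_cat (perm_all _ (perm_path_word _))
             (perm_all _ (perm_tree_word _)) hr'.
by move=> -> /IHr -> // /tree_word_inj ->.
Qed.

(** The overall minimum opens the last block: what precedes it is a shorter word for the right
    subtree, what follows is the word of the left one. *)
Lemma path_word_surj s : uniq (abs_word s) -> all (ltn 0) (abs_word s) ->
  vsd s -> exists t, [/\ increasing t, rightmost_label t <> None & path_word t = s].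
Proof.
have [m] := ubnP (size s); elim: m s => // m IH s sm us ps ds.
have s0 : s != [::] by case: s ds {sm us ps}.
have [u [x [v [es h]]]] := split_at_min s0 us; subst s.
have [u0|u0] := eqVneq u [::].
  (* A minimum in first position excludes a second letter, which would have to be smaller. *)
  move: ds h; rewrite u0 => /= /and3P[x0 hx _].
  case: v hx {s0 us ps sm} => [|y v] /= hx; last by move=> /andP[/=]; lia.
  by exists (Leaf (Some `|x|%N)); split=> //=; congr [:: _]; lia.
have x0 : (0 <= x)%R.
  case: u u0 ds h {s0 us ps sm} => [|y u] //= _ /and3P[_ _ vs].
  rewrite all_cat => /andP[/= xy /andP[hu hv]].
  move: vs; rewrite vsigned_cat_min //; first by case/and3P.
  have /allP : all (ltn `|x|%N) (abs_word (y :: u)) by rewrite /= xy.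
  by apply; exact: mem_last.
move: us ps sm ds; rewrite abs_word_cat cat_uniq all_cat size_cat /=.
move=> /and4P[uu _ _ uv] /and3P[pu px pv] sm.
rewrite -(gez0_abs x0) vsd_cat_min // => /andP[du vv].
have [|r [ir rm er]] := IH u _ uu pu du; first by lia.
have [l [il el]] := tree_word_surj uv pv vv.
exists (Node `|x|%N l r); split=> //=; last by rewrite er el.
rewrite il ir !andbT all_cat -(perm_all _ (perm_path_word r)).
by rewrite -(perm_all _ (perm_tree_word l)) er el andbC -all_cat.
Qed.

(** * From window conditions to [vsd], and the bijection *)

Lemma vsignedP p q s :
  reflect (forall i, i < size s -> (nth 0 s i < 0)%R ->
             nth 0 (q :: abs_word s) i < nth 0 [:: p, q & abs_word s] i /\
             nth 0 (q :: abs_word s) i < nth 0 (abs_word s) i)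
          (vsigned p q s).
Proof.
elim: s p q => [|x s IH] p q /=; first by constructor.
apply: (iffP andP) => [[/implyP hx /IH hs] [|i] //= si|h].
- by move=> /hx /andP.
- exact: hs.
- split; first by apply/implyP => x0; apply/andP; exact: (h 0).
  by apply/IH => i; exact: (h i.+1).
Qed.

Lemma VSDP n s : 1 <= n -> VSD n s <-> signed_perm n s /\ vsd s.
Proof.
move=> n1; rewrite /VSD /=.
suff E : signed_perm n s -> vsd s <->
  [/\ (win s 1 < 0)%R, (2 <= n -> (0 < win s 2 < `|win s 1|)%R)
    & forall i, 3 <= i <= n -> (win s i < 0)%R -> valley (abs_word s) i.-1].
  by split=> [[p a b c]|[p d]]; have [E1 E2] := E p;
    [split=> //; apply: E2|have [] := E1 d].
move=> ps; have := perm_size ps; rewrite size_map size_iota => sn.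
have pos : all (ltn 0) (abs_word s).
  by rewrite (perm_all _ ps); apply/allP => z; rewrite mem_iota => /andP[].
rewrite -sn in n1 ps *; case: s n1 pos {ps sn} => [|x [|y s]] // _ pos.
  rewrite /win /= !andbT; split=> [/andP[x0 _]|[x0 _ _]]; last by rewrite x0; lia.
  by split=> // i /andP[i3 i1]; have := leq_trans i3 i1.
have /and3P[px py _] := pos; rewrite /win /=.
(* Window position [i] is index [i - 3] of [s]. Since [i - 1] is at least 2, the special rule for a
   valley at position 1 never applies. *)
have E : vsigned `|x| `|y| s <->
    forall i, 3 <= i <= (size s).+2 -> (nth 0 [:: x, y & s] i.-1 < 0)%R ->
      valley (abs_word [:: x, y & s]) i.-1.
  split=> [/vsignedP h [|[|[|i]]] // /andP[_ si]|h].
    move=> /(h _ si) [h1 h2]; rewrite /valley /= size_map h1 h2.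
    by rewrite !andbT.
  apply/vsignedP => i si i0; have := h i.+3.
  by rewrite /valley /= size_map => /(_ si i0)/andP[/andP[_ ->] ->].
rewrite /=; split.
  move=> /and4P[x0 yx y0 /E h]; split=> // _.
  by move: y0 py yx; rewrite implybF /=; lia.
case=> x0 /(_ isT) /andP[y0 yx] /E h.
apply/and4P; split=> //; first by lia.
by apply/implyP; lia.
Qed.

Theorem theorem6p3 (n : nat) (hn : (1 <= n)%N) :
  exists phi : seq int -> tree,
    set_bij (VSD n) (Tstar n) phi /\
    (forall k : nat, (1 <= k <= n)%N -> set_bij (VSDk n k) (Tstark n k) phi).
Proof.
have iota_pos w : perm_eq w (iota 1 n) -> all (ltn 0) w.
  by move=> /perm_all ->; apply/allP => z; rewrite mem_iota => /andP[].
(* [phi] is chosen as the inverse of [path_word] on [VSD n]; elsewhere its value is arbitrary. *)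
have surj s : exists t, VSD n s -> Tstar n t /\ path_word t = s.
  have [/VSDP-/(_ hn) [ps ds]|ns] := pselect (VSD n s); last by exists (Leaf None).
  have us : uniq (abs_word s) by rewrite (perm_uniq ps) iota_uniq.
  have [t [it rt et]] := path_word_surj us (iota_pos _ ps) ds.
  exists t => _; split=> //; split=> //; split=> //.
  by rewrite -(permPr ps) -et perm_sym perm_path_word.
have [phi phiP] := choice surj.
have wordVSD t : Tstar n t -> VSD n (path_word t).
  move=> [[pt it] rt]; apply/VSDP => //; split.
    exact: perm_trans (perm_path_word t) pt.
  by apply: vsd_path_word => //; exact: iota_pos.
have wordK t : Tstar n t -> phi (path_word t) = t.
  move=> ht; have [[[p i] r] e] := phiP _ (wordVSD _ ht).
  by case: ht => [[pt it] rt]; apply: path_word_inj e => //; exact: iota_pos.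
have wordk t k : Tstar n t ->
    win (path_word t) 1 = (- Posz k)%R <-> rightmost_label t = Some k.
  move=> [_]; case e: (rightmost_label t) => [j|//] _.
  have [s ->] := path_word_head e; rewrite /win /=.
  by split=> [h|[->] //]; congr Some; lia.
have phi_inj s s' : VSD n s -> VSD n s' -> phi s = phi s' -> s = s'.
  by move=> /phiP[_ {2}<-] /phiP[_ {2}<-] ->.
exists phi; split=> [|k _]; split.
- by move=> s /phiP[].
- by move=> s s' /set_mem hs /set_mem hs'; exact: phi_inj.
- by move=> t ht; exists (path_word t); [exact: wordVSD|exact: wordK].
- by move=> s [/phiP[ht e] hk]; split=> //; apply/wordk => //; rewrite e.
- by move=> s s' /set_mem[hs _] /set_mem[hs' _]; exact: phi_inj.
- move=> t [ht /wordk-/(_ ht) hk]; exists (path_word t); last exact: wordK.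
  by split=> //; exact: wordVSD.
Qed.
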